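(* Let $\mu\in(0,1)$, $P_m\in(0,1)$, $\gamma_s>0$, $\chi^2>0$, $\sigma_u^2>0$, $\sigma_t^2>0$, and let $N_s$ be a positive integer. For secondary transmit power $\sigma_s^2>0$ let $\gamma_t=\sigma_s^2\sigma_t^2/\sigma_u^2$, $\gamma_i=\chi^2\sigma_s^2/\sigma_u^2$, and let $$C=\log_2(1+\gamma_t)\left(1-\frac{\mu}{2}-\frac{\left(\frac1\mu-1\right)P_f^1+1-P_m}{1+\left(\frac1\mu-1\right)\xi}\right)$$ be the secondary throughput, regarded as a function of $\sigma_s^2$ with all other parameters fixed, where $\xi=1-P_f^0+P_f^1$, $$P_f^0=\mathcal Q\left(-\mathcal Q^{-1}(P_m)(1+\gamma_s)+\gamma_s\sqrt{N_s}\right),\qquad P_f^1=\mathcal Q(\rho),$$ $$\rho=-\mathcal Q^{-1}(P_m)\left(\frac{\gamma_s}{\gamma_i+1}+1\right)+\frac{\gamma_s}{\gamma_i+1}\sqrt{N_s}.$$ Put $$\alpha=\left(\tfrac1\mu-1\right)\left(\mathcal Q(\rho)-P_f^0+1\right)+1,\qquad \kappa=\frac{\left(\frac1\mu-1\right)\left(1-P_f^0\right)+P_m}{\left(\frac1\mu-1\right)\left(\mathcal Q(\rho)-P_f^0+1\right)+1},$$ $$\Xi=\gamma_s\chi^2\left(\mathcal Q^{-1}(1-P_m)+\sqrt{N_s}\right).$$ Then every local optimal transmit power, i.e. every $\widehat{\sigma_s^2}>0$ with $\left.\frac{dC}{d\sigma_s^2}\right|_{\widehat{\sigma_s^2}}=0$,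 satisfies (with $\gamma_t,\gamma_i,\rho,\alpha,\kappa$ evaluated at $\sigma_s^2=\widehat{\sigma_s^2}$) $$\kappa\ln(\gamma_t+1)\,\frac{\exp\left(-\frac{\rho^2}{2}\right)\left(\frac1\mu-1\right)\Xi}{\sqrt{2\pi}\,(\gamma_i+1)^2\,\alpha}+\frac{\sigma_t^2\left(\frac{\mu}{2}-\kappa\right)}{\gamma_t+1}=0.$$
   Context: $\mathcal Q(x)=\frac{1}{\sqrt{2\pi}}\int_x^\infty e^{-t^2/2}\,dt$ is the complementary distribution function of the standard Gaussian and $\mathcal Q^{-1}$ its inverse. Interpretation: $\mu$ is the per-slot arrival probability of the primary user; $P_m$ is the common miss-detection probability; $P_f^0$, $P_f^1$ are the false-alarm probabilities when the secondary user is silent or transmitting; $\gamma_s$ is the sensing SNR; $\gamma_t$ the transmission SNR with channel gain $\sigma_t^2$; $\gamma_i$ the residual self-interference-to-noise ratio with suppression factor $\chi^2$ and noise variance $\sigma_u^2$; $N_s$ the number of samples per slot. *)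

(* Defs.v *)
From HB Require Import structures.
From mathcomp Require Import all_boot all_order all_algebra.
From mathcomp Require Import all_classical all_reals all_analysis.

Set Implicit Arguments.
Unset Strict Implicit.
Unset Printing Implicit Defensive.

Import Order.TTheory GRing.Theory Num.Theory.
Import numFieldNormedType.Exports.

Local Open Scope classical_set_scope.
Local Open Scope ring_scope.

Definition log2 (R : realType) (x : R) : R := ln x / ln 2.

Definition gaussQ (R : realType) (x : R) : R :=
  (Num.sqrt (2 * pi))^-1 *
  \int[@lebesgue_measure R]_(t in `[x, +oo[) expR (- (t ^+ 2) / 2).

(* [gaussQ] maps R bijectively onto ]0, 1[, where this is its inverse; the
   value 0 outside ]0, 1[ is a placeholder. *)
Definition gaussQinv (R : realType) : R -> R :=
  'pinv_(fun=> 0) [set: R] (@gaussQ R).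

(* The powers and variances sigma_s^2, sigma_t^2, sigma_u^2 and the factor
   chi^2 are themselves the parameters [ss2], [st2], [su2], [chi2]. *)

Definition gamma_t (R : realType) (st2 su2 ss2 : R) : R := ss2 * st2 / su2.

Definition gamma_i (R : realType) (chi2 su2 ss2 : R) : R := chi2 * ss2 / su2.

Definition Pf0 (R : realType) (Pm gamma_s : R) (Ns : nat) : R :=
  gaussQ (- gaussQinv Pm * (1 + gamma_s) + gamma_s * Num.sqrt Ns%:R).

Definition rho (R : realType) (Pm gamma_s chi2 su2 : R) (Ns : nat) (ss2 : R) : R :=
  - gaussQinv Pm * (gamma_s / (gamma_i chi2 su2 ss2 + 1) + 1)
  + gamma_s / (gamma_i chi2 su2 ss2 + 1) * Num.sqrt Ns%:R.

Definition Pf1 (R : realType) (Pm gamma_s chi2 su2 : R) (Ns : nat) (ss2 : R) : R :=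
  gaussQ (rho Pm gamma_s chi2 su2 Ns ss2).

Definition xi (R : realType) (Pm gamma_s chi2 su2 : R) (Ns : nat) (ss2 : R) : R :=
  1 - Pf0 Pm gamma_s Ns + Pf1 Pm gamma_s chi2 su2 Ns ss2.

(* The secondary throughput C. *)
Definition throughput (R : realType) (mu Pm gamma_s chi2 su2 st2 : R) (Ns : nat)
    (ss2 : R) : R :=
  log2 (1 + gamma_t st2 su2 ss2) *
  (1 - mu / 2 -
   ((mu^-1 - 1) * Pf1 Pm gamma_s chi2 su2 Ns ss2 + 1 - Pm) /
   (1 + (mu^-1 - 1) * xi Pm gamma_s chi2 su2 Ns ss2)).

Definition alpha (R : realType) (mu Pm gamma_s chi2 su2 : R) (Ns : nat)
    (ss2 : R) : R :=
  (mu^-1 - 1) *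
    (gaussQ (rho Pm gamma_s chi2 su2 Ns ss2) - Pf0 Pm gamma_s Ns + 1) + 1.

Definition kappa (R : realType) (mu Pm gamma_s chi2 su2 : R) (Ns : nat)
    (ss2 : R) : R :=
  ((mu^-1 - 1) * (1 - Pf0 Pm gamma_s Ns) + Pm) /
  ((mu^-1 - 1) *
     (gaussQ (rho Pm gamma_s chi2 su2 Ns ss2) - Pf0 Pm gamma_s Ns + 1) + 1).

Definition Xi (R : realType) (Pm gamma_s chi2 : R) (Ns : nat) : R :=
  gamma_s * chi2 * (gaussQinv (1 - Pm) + Num.sqrt Ns%:R).

(* Main.v *)
Require Import Defs.
From HB Require Import structures.
From mathcomp Require Import all_boot all_order all_algebra.
From mathcomp Require Import all_classical all_reals all_analysis.
From mathcomp Require Import ring lra.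

Set Implicit Arguments.
Unset Strict Implicit.
Unset Printing Implicit Defensive.

Import Order.TTheory GRing.Theory Num.Theory.
Import numFieldNormedType.Exports.

Local Open Scope classical_set_scope.
Local Open Scope ring_scope.

(** Since alpha - ((1/mu - 1) P_f^1 + 1 - P_m) is the numerator of kappa, the
    throughput is C = log_2 (1 + gamma_t) (kappa - mu / 2), and only the
    denominator alpha of kappa depends on the transmit power, through
    Q(rho). By Q' = - phi, with phi the standard Gaussian density, the
    product and chain rules turn dC = 0, divided by the nonzero constant
    - 1 / (sigma_u^2 ln 2), into the claimed equation. The constant Xi involves
    Q^-1(1 - P_m), which equals - Q^-1(P_m) because Q(-x) = 1 - Q(x) and Q is
    a bijection from the reals onto ]0, 1[. *)

(** * The Gaussian tail function: derivative, symmetry, inverse *)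

Section GaussQ.
Context {R : realType}.
Implicit Types x y p : R.
(** The identity, seen as a random variable [X] under the standard normal law [P], makes the theory
    of [cdf] available for the Gaussian tail. *)
Let P : probability (measurableTypeR R) R := normal_prob (0 : R) 1.
Let idTR : measurableTypeR R -> R := idfun.
#[local] HB.instance Definition _ := @isMeasurableFun.Build _ _ _ _ idTR
  (@measurable_id _ _ setT).
Let X : {RV P >-> R} := (idTR : {RV P >-> R}).

Lemma normal_pdf01E x :
  normal_pdf 0 1 x = (Num.sqrt (2 * pi))^-1 * expR (- (x ^+ 2) / 2).
Proof.
rewrite normal_pdfE ?oner_neq0// /normal_peak /normal_fun subr0 expr1n mul1r.
by rewrite -[pi *+ 2]mulr_natl.
Qed.

Lemma normal_pdf01N x : normal_pdf 0 1 (- x) = normal_pdf 0 1 x.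
Proof. by rewrite !normal_pdf01E sqrrN. Qed.

Lemma normal_pdf01_gt0 x : 0 < normal_pdf 0 1 x.
Proof.
rewrite normal_pdf01E mulr_gt0 ?expR_gt0// invr_gt0 sqrtr_gt0.
by rewrite mulr_gt0 ?pi_gt0.
Qed.

Lemma integrable_normal_pdf01 (D : set R) : measurable D ->
  (@lebesgue_measure R).-integrable D (EFin \o normal_pdf 0 1).
Proof.
by move=> mD; apply: (integrableS _ _ (subsetT _)) => //;
  exact: integrable_normal_pdf.
Qed.

Lemma gaussQ_normal_pdf x :
  gaussQ x = \int[@lebesgue_measure R]_(t in `[x, +oo[) normal_pdf 0 1 t.
Proof.
rewrite /gaussQ -RintegralZl//.
  by apply: eq_Rintegral => t _; rewrite normal_pdf01E.
(* Integrability of exp(-t^2/2) remains: this function is [c^-1] times the density. *)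
pose c : R := (Num.sqrt (2 * pi))^-1.
have c0 : c != 0 by rewrite invr_neq0// gt_eqF// sqrtr_gt0 mulr_gt0 ?pi_gt0.
have := integrable_normal_pdf01 (measurable_itv `[x, +oo[).
move=> /(integrableZl _ c^-1) int; have {int} := int (measurable_itv _).
apply: eq_integrable => // t _ /=.
by rewrite normal_pdf01E -EFinM mulKf.
Qed.

(* The FTC of the library differentiates an integral in its upper bound only. *)
Lemma gaussQ_lower_tail x : gaussQ x =
  \int[@lebesgue_measure R]_(t in `]-oo, - x]) normal_pdf 0 1 t.
Proof.
rewrite gaussQ_normal_pdf /Rintegral ge0_integration_by_substitutionNy.
- by congr fine; apply: eq_integral => t _ /=; rewrite normal_pdf01N.
- apply: continuous_subspaceT; exact: continuous_normal_pdf (oner_neq0 _).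
- by move=> t _; exact: normal_pdf_ge0.
Qed.

Lemma gaussQE x : gaussQ x = fine (cdf X (- x)).
Proof. by rewrite gaussQ_lower_tail. Qed.

Global Instance is_derive_gaussQ x :
  is_derive x 1 (@gaussQ R) (- normal_pdf 0 1 x).
Proof.
pose F y := \int[@lebesgue_measure R]_(t in `]-oo, y]) normal_pdf 0 1 t.
have -> : @gaussQ R = F \o -%R.
  by apply/funext => y; rewrite gaussQ_lower_tail.
rewrite -mulrN1.
apply: is_derive1_comp.
(* Any bound beyond [- x] would do in place of [- x + 1]: it only makes [- x] interior to the domain
   of integrability. *)
have [||||d e] := @continuous_FTC1 R (normal_pdf 0 1) -oo%O (- x) (- x + 1).
- by rewrite ltrDl.
- exact: integrable_normal_pdf01.
- by rewrite ltNyr.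
- exact: (continuous_normal_pdf (oner_neq0 _)).
- by apply: DeriveDef => //; rewrite -derive1E e normal_pdf01N.
Qed.

(** The lower tail up to [x] and the upper tail from [x] share the total mass 1; the endpoint is
    dropped from one ray to make them disjoint. *)
Lemma gaussQN x : gaussQ (- x) = 1 - gaussQ x.
Proof.
apply/eqP; rewrite eq_sym subr_eq; apply/eqP.
rewrite gaussQ_lower_tail opprK gaussQ_normal_pdf.
rewrite -(@Rintegral_itv_obnd_cbnd _ x); last exact: integrable_normal_pdf01.
rewrite -Rintegral_setU//.
- rewrite itv_setU_setT /Rintegral integral_normal_pdf//.
- by apply: integrable_normal_pdf01; exact: measurableU.
- exact: disjoint_rays.
Qed.

Lemma gaussQ_decr : {homo @gaussQ R : x y /~ x < y}.
Proof.
move=> y x xy.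
have [|c _ e] := @MVT _ (@gaussQ R) (fun x => - normal_pdf 0 1 x) _ _ xy.
- by apply: derivable_within_continuous => t _; exact: ex_derive.
- by rewrite -subr_lt0 e nmulr_rlt0 ?subr_gt0// oppr_lt0 normal_pdf01_gt0.
Qed.

Lemma gaussQ_inj : injective (@gaussQ R).
Proof.
move=> x y e; have [xy|xy|//] := ltgtP x y;
  by have := gaussQ_decr xy; rewrite e ltxx.
Qed.

(** Strict decrease gives Q(x) > Q(x + 1), and the latter is nonnegative as a value of a
    distribution function. *)
Lemma gaussQ_gt0 x : 0 < gaussQ x.
Proof.
apply: le_lt_trans (gaussQ_decr (_ : x < x + 1)); last by rewrite ltrDl.
by rewrite gaussQE fine_ge0// cdf_ge0.
Qed.

Lemma gaussQ_lt1 x : gaussQ x < 1.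
Proof. by rewrite -subr_gt0 -gaussQN gaussQ_gt0. Qed.

Lemma continuous_gaussQ : continuous (@gaussQ R).
Proof.
by move=> x; apply: differentiable_continuous; apply/derivable1_diffP;
  exact: ex_derive.
Qed.

(** Intermediate value theorem between a point where Q is below [p] and one where it is above. *)
Lemma gaussQ_surj p : 0 < p < 1 -> exists x, gaussQ x = p.
Proof.
move=> /andP[p0 p1].
(* Q takes arbitrarily small values, since the distribution function of [X] tends to 0 at minus
   infinity. *)
have small q : 0 < q -> exists x, gaussQ x < q.
  move=> q0.
  have /fine_cvg h := cvg_cdfNy0 X.
  have /(_ _ q0)[M [_ hM]] := cvgr_lt _ h q.
  exists (- (M - 1)); rewrite gaussQE opprK; apply: hM.
  by rewrite ltrBlDr ltrDl.
have [x xp] := small _ p0.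
(* By symmetry, Q(y) < 1 - p means p < Q(-y). *)
have [y] := small (1 - p) ltac:(by rewrite subr_gt0).
rewrite ltrBrDl -ltrBrDr -gaussQN => yp.
have yx : - y <= x.
  rewrite leNgt; apply/negP => /gaussQ_decr.
  by rewrite ltNge (ltW (lt_trans xp yp)).
have [||c _ <-] := @IVT _ (@gaussQ R) (- y) x p yx; last by exists c.
- exact: (continuous_subspaceT continuous_gaussQ).
- by rewrite ge_min le_max (ltW xp) (ltW yp) orbT.
Qed.

Lemma gaussQinvK p : 0 < p < 1 -> gaussQ (gaussQinv p) = p.
Proof.
by move=> /gaussQ_surj[x xp]; rewrite /gaussQinv pinvK// inE; exists x.
Qed.

Lemma gaussQinv_onem p : 0 < p < 1 -> gaussQinv (1 - p) = - gaussQinv p.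
Proof.
move=> p01; apply: gaussQ_inj.
rewrite gaussQN !gaussQinvK//; case/andP: p01 => p0 p1.
by rewrite subr_gt0 p1 ltrBlDr ltrDl.
Qed.
End GaussQ.

(** * Differentiating the throughput in the transmit power *)

Lemma is_derive_affine (R : realType) (a b x : R) :
  is_derive x 1 (fun y => a * y + b) a.
Proof.
apply: (@is_derive_eq _ _ _ (a \*: id + cst b) _ _ _ _ _).
by rewrite addr0 [_ *: _]mulr1.
Qed.

Section Throughput.
Context {R : realType}.
Variables (mu Pm gamma_s chi2 su2 st2 : R) (Ns : nat).
Hypotheses (mu_gt0 : 0 < mu) (mu_lt1 : mu < 1).
Hypotheses (Pm_gt0 : 0 < Pm) (Pm_lt1 : Pm < 1).
Hypotheses (chi2_gt0 : 0 < chi2) (su2_gt0 : 0 < su2) (st2_gt0 : 0 < st2).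
Variable s : R.
Hypothesis s_gt0 : 0 < s.

Local Notation gi := (gamma_i chi2 su2).
Local Notation gt := (gamma_t st2 su2).
Local Notation Rho := (rho Pm gamma_s chi2 su2 Ns).
Local Notation Al := (alpha mu Pm gamma_s chi2 su2 Ns).
Local Notation Ka := (kappa mu Pm gamma_s chi2 su2 Ns).
Local Notation XI := (Xi Pm gamma_s chi2 Ns).

(** Here 1/mu - 1 >= 0, Q(rho) > 0 and P_f^0 < 1, so 1 is added to a nonnegative product. *)
Lemma alpha_gt0 x : 0 < Al x.
Proof.
rewrite /alpha ltr_wpDl// mulr_ge0//.
  by rewrite subr_ge0 invf_ge1// ltW.
have := gaussQ_gt0 (Rho x).
have := gaussQ_lt1 (- gaussQinv Pm * (1 + gamma_s) + gamma_s * Num.sqrt Ns%:R).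
by rewrite /Pf0; lra.
Qed.

Lemma gamma_i_gt0 : 0 < gi s.
Proof. by rewrite /gamma_i divr_gt0// mulr_gt0. Qed.

Lemma gamma_t_gt0 : 0 < gt s.
Proof. by rewrite /gamma_t divr_gt0// mulr_gt0. Qed.

Lemma throughputE :
  throughput mu Pm gamma_s chi2 su2 st2 Ns =
  fun x => (ln 2)^-1 * (ln (st2 / su2 * x + 1) * (Ka x - mu / 2)).
Proof.
apply/funext => x; rewrite /throughput /log2 /kappa /xi /Pf1.
have := alpha_gt0 x; rewrite /alpha /gamma_t.
rewrite (_ : 1 + x * st2 / su2 = st2 / su2 * x + 1); last by ring.
(* With the transcendental terms abstracted, a rational identity remains. *)
move: (gaussQ (Rho x)) => q.
move: (Pf0 _ _ _) => p0.
move: (ln _) => L; move: (ln 2)^-1 => L2.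
move: (mu^-1 - 1) => a D_gt0.
rewrite (_ : 1 + a * (1 - p0 + q) = a * (q - p0 + 1) + 1); last by ring.
have D0 : a * (q - p0 + 1) + 1 != 0 by rewrite gt_eqF.
rewrite [L * L2]mulrC -mulrA; congr (_ * (_ * _)).
by field.
Qed.

Lemma is_derive_rho :
  is_derive s 1 Rho (- (XI / su2 / (gi s + 1) ^+ 2)).
Proof.
have gi0 : gi s + 1 != 0 by rewrite gt_eqF// addr_gt0// gamma_i_gt0.
set u := fun x : R => chi2 / su2 * x + 1.
have giE x : gi x + 1 = u x by rewrite /gamma_i /u mulrAC.
set b := - gaussQinv Pm.
(* [Rho] is affine in 1/u with slope [k], and [XI] is [chi2 * k] once Q^-1(1 - P_m) is rewritten as
   [b]. *)
set k := gamma_s * (b + Num.sqrt Ns%:R).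
have -> : Rho = k \*: (fun x => (u x)^-1) + cst b.
  apply/funext => x; rewrite /rho giE fctE /= -/b /k [_ *: _]/GRing.scale /=.
  by ring.
have du : is_derive s 1 u (chi2 / su2) by exact: is_derive_affine.
rewrite giE in gi0 *.
have dV := is_deriveV gi0 du.
apply: is_derive_eq.
rewrite /Xi gaussQinv_onem ?Pm_gt0// -/b subr0 /k.
rewrite [_ *: _]/GRing.scale /= [_ *: _]/GRing.scale /=.
by field; rewrite gi0 gt_eqF.
Qed.

Lemma is_derive_Pf1 :
  is_derive s 1 (Pf1 Pm gamma_s chi2 su2 Ns)
    (normal_pdf 0 1 (Rho s) * (XI / su2 / (gi s + 1) ^+ 2)).
Proof.
have dr := is_derive_rho.
apply: (@is_derive_eq _ _ _ (@gaussQ R \o Rho) _ _ _ _ _).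
by rewrite mulrNN.
Qed.

(** With kappa = N / alpha and N constant, kappa' = - kappa alpha' / alpha, where alpha' = (1/mu -
    1) (P_f^1)'. *)
Lemma is_derive_kappa :
  is_derive s 1 Ka (- Ka s * ((mu^-1 - 1) * (normal_pdf 0 1 (Rho s) *
    (XI / su2 / (gi s + 1) ^+ 2))) / Al s).
Proof.
have dP := is_derive_Pf1.
set N := (mu^-1 - 1) * (1 - Pf0 Pm gamma_s Ns) + Pm.
set c := (mu^-1 - 1) * (1 - Pf0 Pm gamma_s Ns) + 1.
have -> : Ka = N \*: (fun x => (Al x)^-1) by [].
have A0 : Al s != 0 by rewrite gt_eqF ?alpha_gt0.
set dp := (X in - _ * (_ * X)).
have dA : is_derive s 1 Al ((mu^-1 - 1) * dp).
  have -> : Al = (mu^-1 - 1) \*: Pf1 Pm gamma_s chi2 su2 Ns + cst c.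
    apply/funext => x; rewrite /alpha /c fctE /= [_ *: _]/GRing.scale /= /Pf1.
    by ring.
  by apply: is_derive_eq; rewrite addr0.
have dV := is_deriveV A0 dA.
apply: is_derive_eq.
rewrite [(_ \*: _) s]/= ![_ *: _]/GRing.scale /=.
by field; rewrite A0 gt_eqF.
Qed.

(** Product rule on the form given by [throughputE]; the common factor 1 / (sigma_u^2 ln 2) is
    pulled out so that it can be cancelled. *)
Lemma derive1_throughput :
  derive1 (throughput mu Pm gamma_s chi2 su2 st2 Ns) s =
  (ln 2)^-1 * su2^-1 * (st2 * (Ka s - mu / 2) / (gt s + 1)
   - Ka s * ln (gt s + 1) * (normal_pdf 0 1 (Rho s) * (mu^-1 - 1) * XI /
   ((gi s + 1) ^+ 2 * Al s))).
Proof.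
have dK := is_derive_kappa.
have A0 : Al s != 0 by rewrite gt_eqF ?alpha_gt0.
have gi0 : gi s + 1 != 0 by rewrite gt_eqF// addr_gt0// gamma_i_gt0.
have gtE : gt s + 1 = st2 / su2 * s + 1 by rewrite /gamma_t; ring.
have gt0 : 0 < gt s + 1 by rewrite addr_gt0// gamma_t_gt0.
have da : is_derive s 1 (fun x => st2 / su2 * x + 1) (st2 / su2).
  exact: is_derive_affine.
have dl : is_derive (st2 / su2 * s + 1) 1 (@ln R) (gt s + 1)^-1.
  by rewrite -gtE; exact: is_derive1_ln.
have dL := @is_derive1_comp _ (@ln R) (fun x => st2 / su2 * x + 1) s _ _ dl da.
rewrite throughputE derive1E.
apply: derive_val.
apply: (@is_derive_eq _ _ _ ((ln 2)^-1 \*: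
  ((@ln R \o (fun x => st2 / su2 * x + 1)) * (Ka - cst (mu / 2)))) _ _ _ _ _).
rewrite !fctE /= ![_ *: _]/GRing.scale /= -gtE.
by field; rewrite gi0 A0 !gt_eqF// ln_gt0// ltr1n.
Qed.

End Throughput.

Theorem mainTheorem6 (R : realType)
    (mu Pm gamma_s chi2 su2 st2 : R) (Ns : nat)
    (mu_gt0 : 0 < mu) (mu_lt1 : mu < 1)
    (Pm_gt0 : 0 < Pm) (Pm_lt1 : Pm < 1)
    (gamma_s_gt0 : 0 < gamma_s) (chi2_gt0 : 0 < chi2)
    (su2_gt0 : 0 < su2) (st2_gt0 : 0 < st2) (Ns_gt0 : (0 < Ns)%N)
    (ss2 : R) (ss2_gt0 : 0 < ss2)
    (ss2_opt : derive1 (throughput mu Pm gamma_s chi2 su2 st2 Ns) ss2 = 0) :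
  kappa mu Pm gamma_s chi2 su2 Ns ss2 * ln (gamma_t st2 su2 ss2 + 1) *
    (expR (- (rho Pm gamma_s chi2 su2 Ns ss2 ^+ 2) / 2) * (mu^-1 - 1) *
       Xi Pm gamma_s chi2 Ns /
     (Num.sqrt (2 * pi) * (gamma_i chi2 su2 ss2 + 1) ^+ 2 *
        alpha mu Pm gamma_s chi2 su2 Ns ss2)) +
  st2 * (mu / 2 - kappa mu Pm gamma_s chi2 su2 Ns ss2) /
    (gamma_t st2 su2 ss2 + 1) = 0.
Proof.
have A0 : alpha mu Pm gamma_s chi2 su2 Ns ss2 != 0.
  by rewrite gt_eqF ?alpha_gt0.
have gi0 : gamma_i chi2 su2 ss2 + 1 != 0.
  by rewrite gt_eqF// addr_gt0// gamma_i_gt0.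
have gt0 : gamma_t st2 su2 ss2 + 1 != 0.
  by rewrite gt_eqF// addr_gt0// gamma_t_gt0.
have spi0 : Num.sqrt (2 * pi) != 0 :> R.
  by rewrite gt_eqF// sqrtr_gt0 mulr_gt0 ?pi_gt0.
move/eqP: ss2_opt; rewrite derive1_throughput// mulf_eq0 gt_eqF/=; last first.
  by rewrite mulr_gt0 ?invr_gt0// ln_gt0// ltr1n.
(* The vanishing bracket is the opposite of the claimed left-hand side; its negation replaces the 0
   on the right. *)
rewrite normal_pdf01E => /eqP/(congr1 -%R); rewrite oppr0 => <-.
by field; rewrite A0 gi0 gt0 spi0 gt_eqF.
Qed.
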